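(* Let $k$ be an algebraically closed field of characteristic $p$, let $G$ be a finite group acting rigidly on an abelian variety $A$ over $k$ (preserving the group law), and let $\ell$ be a prime. If $\ell=p$, assume that $f(A)>0$. Let $r\geq 1$ be an integer. (1) If $P\in A$ is a point fixed by an element $g\in G$ of order $\ell^r$, then $P\in A[\ell](k)$. (2) If $G=C_{\ell^r}$, the set of fixed points of $G$ is a subgroup of $A[\ell](k)$ of order $\ell^m$, where $$m=\frac{\log_\ell(\#A[\ell])}{(\ell-1)\ell^{r-1}}.$$
   Context: ''Preserving the group law'' means that $G$ acts through an injective homomorphism $G\hookrightarrow\mathrm{End}(A)^\times$. The action is rigid if every non-trivial $g\in G$ fixes a finite, non-zero number of points of $A$. $f(A)$ is the $p$-rank of $A$, i.e. $\#A[p](k)=p^{f(A)}$. $\#A[\ell]$ denotes the number of points of $A[\ell](k)$. $C_n$ denotes the cyclic group of order $n$. *)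

(* Defs.v *)
From HB Require Import structures.
From mathcomp Require Import all_boot all_order all_algebra all_fingroup.
From mathcomp Require Import all_solvable.
From mathcomp Require Import mpoly.
From mathcomp Require Import boolp classical_sets functions cardinality.

Set Implicit Arguments.
Unset Strict Implicit.
Unset Printing Implicit Defensive.

Import GRing.Theory.

Local Open Scope ring_scope.
Local Open Scope classical_set_scope.
Local Open Scope card_scope.

(* Varieties over an algebraically closed field k are taken in the classical
   sense (sets of closed points, i.e. of k-points, with a finite atlas of
   affine charts); they correspond to the integral separated schemes of finite
   type over k, and A(k) is the type of points.

   An atlas is the bare data of charts; the conditions turning it into a
   variety are in [prevariety] and [variety].  Only the values of
   [coord i] on [dom i] are meaningful. *)
Record atlas (k : closedFieldType) := Atlas {
  point :> Type;
  chart : finType;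
  dim : chart -> nat;
  dom : chart -> set point;
  coord : forall i : chart, point -> 'rV[k]_(dim i) }.

Section Varieties.
Variable k : closedFieldType.

Definition zero_locus n (S : set {mpoly k[n]}) : set 'rV[k]_n :=
  [set v | forall P, S P -> P.@[v ord0] = 0].

Definition zclosed (X : atlas k) (Z : set X) : Prop :=
  forall i : chart X, exists S : set {mpoly k[dim i]},
    dom i `&` Z = dom i `&` coord i @^-1` zero_locus S.

Definition zopen (X : atlas k) (U : set X) : Prop := zclosed (~` U).

(* A function is regular on U when, in every chart, it is locally on U a
   quotient of two polynomials in the coordinates.  The values of f outside U
   play no role. *)
Definition regular (X : atlas k) (U : set X) (f : X -> k) : Prop :=
  forall (i : chart X) (x : X), U x -> dom i x ->
    exists P Q : {mpoly k[dim i]}, Q.@[coord i x ord0] != 0 /\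
      forall y : X, U y -> dom i y -> Q.@[coord i y ord0] != 0 ->
        f y = P.@[coord i y ord0] / Q.@[coord i y ord0].

(* The last two conditions say that the overlaps are open in each chart and
   that the changes of coordinates are regular. *)
Definition prevariety (X : atlas k) : Prop :=
  [/\ forall x : X, exists i : chart X, dom i x,
      forall i : chart X, set_inj (dom i) (coord i),
      forall i : chart X, exists S : set {mpoly k[dim i]},
        coord i @` dom i = zero_locus S,
      forall i : chart X, zopen (dom i)
    & forall (i : chart X) (c : 'I_(dim i)),
        regular (dom i) (fun x => coord i x ord0 c)].

Definition irreducible (X : atlas k) : Prop :=
  [set: X] !=set0 /\
  forall Y Z : set X, zclosed Y -> zclosed Z -> Y `|` Z = setT ->
    Y = setT \/ Z = setT.

(* The charts of the product are the products of charts, so that its topology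
   is the Zariski topology and not the product topology. *)
Definition prod_atlas (X Y : atlas k) : atlas k :=
  @Atlas k (X * Y)%type (chart X * chart Y)%type
    (fun ij => (dim ij.1 + dim ij.2)%N)
    (fun ij => dom ij.1 `*` dom ij.2)
    (fun ij xy => row_mx (coord ij.1 xy.1) (coord ij.2 xy.2)).

Definition separated (X : atlas k) : Prop :=
  @zclosed (prod_atlas X X) [set xy | xy.1 = xy.2].

Definition variety (X : atlas k) : Prop :=
  [/\ prevariety X, irreducible X & separated X].

Definition complete (X : atlas k) : Prop :=
  forall Y : atlas k, variety Y ->
    forall Z : set (prod_atlas X Y), zclosed Z -> zclosed (snd @` Z : set Y).

Definition zmorphism (X Y : atlas k) (f : X -> Y) : Prop :=
  forall V : set Y, zopen V ->
    zopen (f @^-1` V) /\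
    forall phi : Y -> k, regular V phi -> regular (f @^-1` V) (phi \o f).

(* Commutativity of the group law is not required: it is a theorem for
   complete group varieties. *)
Record abelian_variety := AbelianVariety {
  av_atlas :> atlas k;
  av_add : av_atlas -> av_atlas -> av_atlas;
  av_opp : av_atlas -> av_atlas;
  av_zero : av_atlas;
  av_variety : variety av_atlas;
  av_complete : complete av_atlas;
  av_add_morph :
    @zmorphism (prod_atlas av_atlas av_atlas) av_atlas
      (fun xy => av_add xy.1 xy.2);
  av_opp_morph : zmorphism av_opp;
  av_addA : associative av_add;
  av_add0 : left_id av_zero av_add;
  av_addN : left_inverse av_zero av_opp av_add }.

Variable A : abelian_variety.

Definition av_muln (n : nat) (x : A) : A := iter n (av_add x) (av_zero A).

Definition av_torsion (n : nat) : set A := [set x | av_muln n x = av_zero A].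

Definition av_subgroup (H : set A) : Prop :=
  [/\ H (av_zero A),
      forall x y, H x -> H y -> H (av_add x y)
    & forall x, H x -> H (av_opp x)].

Definition av_endo (f : A -> A) : Prop :=
  zmorphism f /\ {morph f : x y / av_add x y}.

Definition av_endo_unit (f : A -> A) : Prop :=
  av_endo f /\ exists g : A -> A, [/\ av_endo g, cancel f g & cancel g f].

(* The f such that #A[p](k) = p ^ f (0 is a default value). *)
Definition av_p_rank (p : nat) : nat :=
  xget 0%N [set f : nat | av_torsion p #= `I_(p ^ f)].

Variable gT : finGroupType.

Definition av_action (rho : gT -> A -> A) : Prop :=
  [/\ forall g, av_endo_unit (rho g),
      forall g h, rho (g * h)%g = rho g \o rho h
    & injective rho].

Definition fixed_by (rho : gT -> A -> A) (g : gT) : set A :=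
  [set x | rho g x = x].

Definition fixed_points (rho : gT -> A -> A) : set A :=
  [set x | forall g, rho g x = x].

Definition rigid (rho : gT -> A -> A) : Prop :=
  forall g : gT, g <> 1%g ->
    finite_set (fixed_by rho g) /\ fixed_by rho g !=set0.

End Varieties.

Arguments av_muln {k A} n x.
Arguments av_torsion {k} A n _.

(* The characteristic as a natural number, which is 0 or a prime. *)
Definition has_characteristic (k : closedFieldType) (p : nat) : Prop :=
  (p \in [pchar k]) \/ (p = 0%N /\ [pchar k] =i pred0).

(* Main.v *)
From Pilot Require Import Defs.
From HB Require Import structures.
From mathcomp Require Import all_boot all_order all_algebra all_fingroup.
From mathcomp Require Import all_solvable.
From mathcomp Require Import mpoly finmap.
From mathcomp Require Import boolp classical_sets functions cardinality.
(* From here on [dom] is the domain of a chart, not of a group morphism. *)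
Import Pilot.Defs.

Set Implicit Arguments.
Unset Strict Implicit.
Unset Printing Implicit Defensive.

Import GRing.Theory.

Local Open Scope ring_scope.
Local Open Scope classical_set_scope.
Local Open Scope card_scope.

(** Let [g] have order [l ^ r.+1] and put [h := g ^ (l ^ r)], an element of
    order [l].  The sum [x + h x + ... + h^(l-1) x] is fixed by [h], so it takes
    finitely many values by rigidity; since [A] is irreducible it is constant,
    hence zero ([orbit_sum_eq0]).  A point [P] fixed by [g] is fixed by [h] and
    the sum at [P] is [l P], so [l P = 0]: this is part (1).

    For part (2) put [f := g - 1] and [d := (l - 1) l ^ r].  The vanishing of the
    sum says that [g] is killed by the [l ^ r.+1]-th cyclotomic polynomial, which
    has the form [(X - 1)^d + l U] with [U(1) = 1] ([cyclotomic_congr]).  Hence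
    [f^d = - l U(g)], where [U(g)] is injective on the kernel of [f^d] because
    [U(g) - 1] is a multiple of the nilpotent [f] there; so [A[l]] is the kernel
    of [f^d] ([torsion_iter_kernel]).  In particular [A[l]] is finite, in every
    characteristic.  The fixed points form the kernel [F] of [f], and [f] is
    surjective because its kernel is finite ([finite_kernel_surjective]), so
    [#A[l] = #F ^ d] ([iter_kernel_card]).  Finally [F] is a finite group killed
    by [l], so [#F] is a power of [l] ([exponent_prime_card]).

    Three facts of algebraic geometry are used.
    - The group law is commutative ([av_addC]): by the rigidity argument the
      commutator of [x] and [y], which for [y] near [0] stays in an affine chart,
      is a regular function of [x] on a complete variety, hence constant
      ([complete_regular_cst]).
    - The image of a complete variety is closed ([zclosed_range]).
    - Closed sets satisfy the descending chain condition
      ([zclosed_stationary]), by the basis theorem [noetherian_mpoly].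
    The last two replace dimension theory in the surjectivity of [f]: the closed
    sets [f^n A] stabilise, so [A] is a finite union of translates of [f A], and
    irreducibility makes one of them all of [A]. *)

(** * Hilbert's basis theorem *)

Definition is_ideal (R : comNzRingType) (I : set R) : Prop :=
  [/\ I 0, forall a b, I a -> I b -> I (a + b) & forall a b, I b -> I (a * b)].

Definition ascending T (I : nat -> set T) : Prop :=
  forall i j, (i <= j)%N -> I i `<=` I j.

Definition stationary T (I : nat -> set T) : Prop :=
  exists N, forall n, (N <= n)%N -> I n `<=` I N.

(** The ascending chain form, rather than finite generation: both the proof of
    the basis theorem and its geometric application are about chains. *)
Definition noetherian (R : comNzRingType) : Prop :=
  forall I : nat -> set R,
    (forall n, is_ideal (I n)) -> ascending I -> stationary I.

Lemma noetherian_field (F : fieldType) : noetherian F.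
Proof.
move=> I idI ascI.
have [[N [a Ia a0]]|noU] := pselect (exists N, exists2 a, I N a & a != 0).
  by exists N => n _ b _; have [_ _ /(_ (b / a) a Ia)] := idI N; rewrite divfK.
exists 0%N => n _ a Ia; have [->|a0] := eqVneq a 0; first by case: (idI 0%N).
by case: noU; exists n, a.
Qed.

Lemma noetherian_surj (R S : comNzRingType) (q : {rmorphism R -> S}) :
  (forall y, exists x, q x = y) -> noetherian R -> noetherian S.
Proof.
move=> surj_q noethR I idI ascI.
have [n|i j leij x|N stat] := noethR (fun n => q @^-1` I n).
- have [I0 ID IM] := idI n; split=> /= [|a b Ia Ib|a b Ib].
  + by rewrite rmorph0.
  + by rewrite rmorphD; apply: ID.
  + by rewrite rmorphM; apply: IM.
- exact: (ascI i j leij).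
exists N => n leNn y; have [x <-] := surj_q y; exact: (stat n leNn).
Qed.

Lemma stationary_uniform T (I : nat -> nat -> set T) (b : nat) :
  (forall d, ascending (I d)) -> (forall d, stationary (I d)) ->
  exists N, forall d n, (d < b)%N -> (N <= n)%N -> I d n `<=` I d N.
Proof.
move=> ascI statI; elim: b => [|b [N stat]]; first by exists 0%N.
have [M statb] := statI b; exists (maxn N M) => d n.
rewrite ltnS leq_eqVlt geq_max => /orP[/eqP->|ltdb] /andP[leNn leMn] x Ix.
  by apply: (ascI b M); rewrite ?leq_maxr //; apply: (statb n).
by apply: (ascI d N); rewrite ?leq_maxl //; apply: (stat d n).
Qed.

(** Coefficients of degree [d], so that [0] is included and the set is an ideal. *)
Definition leading_coefs (R : comNzRingType) (I : set {poly R}) (d : nat) :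
    set R :=
  [set a | exists2 P : {poly R}, I P & (size P <= d.+1)%N /\ P`_d = a].

Lemma leading_coefs_ideal (R : comNzRingType) (I : set {poly R}) d :
  is_ideal I -> is_ideal (leading_coefs I d).
Proof.
move=> [I0 ID IM]; split=> [|a b [P IP [sP <-]] [Q IQ [sQ <-]]|a b [P IP [sP <-]]].
- by exists 0; rewrite ?size_poly0 ?coef0.
- exists (P + Q); first exact: ID.
  by split; rewrite ?coefD // (leq_trans (size_polyD _ _)) // geq_max sP.
- exists (a%:P * P); first exact: IM.
  rewrite mul_polyC; split; first exact: leq_trans (size_scale_leq _ _) sP.
  by rewrite coefZ.
Qed.

(** Multiplying by a power of ['X] moves a leading coefficient to a higher
    degree, so the ideals of leading coefficients increase with the degree too. *)
Lemma leading_coefs_shift (R : comNzRingType) (I J : set {poly R}) i j :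
  is_ideal J -> I `<=` J -> (i <= j)%N ->
  leading_coefs I i `<=` leading_coefs J j.
Proof.
move=> [_ _ JM] subIJ leij a [P IP [sP <-]].
exists ('X^(j - i) * P); first exact/JM/subIJ.
rewrite coefXnM ltnNge leq_subr /= subKn //; split=> //.
have [->|P0] := eqVneq P 0; first by rewrite mulr0 size_poly0.
rewrite mulrC size_Mmonic ?monicXn // size_polyXn addnS /=.
by rewrite (leq_trans (leq_add sP (leqnn _))) // addSn subnKC.
Qed.

(** Subtracting from [P] in [J] an element of [I] with the same leading
    coefficient lowers the degree; so nested ideals with the same leading
    coefficients are equal. *)
Lemma leading_coefs_eq (R : comNzRingType) (I J : set {poly R}) :
  is_ideal I -> is_ideal J -> I `<=` J ->
  (forall d, leading_coefs J d `<=` leading_coefs I d) -> J `<=` I.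
Proof.
move=> [I0 ID IM] [J0 JD JM] subIJ leadJI P.
have [n] := ubnP (size P); elim: n P => // n IHn P sP JP.
case: n => [|n] in IHn sP *.
  by move: sP; rewrite ltnS leqn0 size_poly_eq0 => /eqP->.
have [|Q IQ [sQ eqQP]] := leadJI n P`_n; first by exists P.
rewrite -(subrK Q P); apply: ID => //; apply: IHn; last first.
  by rewrite -mulN1r; apply: JD => //; apply: JM; apply: subIJ.
rewrite ltnS; apply/leq_sizeP => j; rewrite leq_eqVlt coefB.
move=> /orP[/eqP<-|ltnj]; first by rewrite eqQP subrr.
by rewrite !nth_default ?subrr // (leq_trans _ ltnj).
Qed.

(** The ideals [L d n] of leading coefficients in degree [d] of the elements of
    [I n] increase in both indices.  The diagonal [L n n] is stationary from
    some [D] on, which settles all degrees [d >= D] at once, and the finitely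
    many chains [L d] with [d < D] are stationary from a common rank. *)
Theorem hilbert_basis (R : comNzRingType) :
  noetherian R -> noetherian {poly R}.
Proof.
move=> noethR I idI ascI; pose L d n := leading_coefs (I n) d.
have idL d n : is_ideal (L d n) by apply: leading_coefs_ideal.
have ascL d : ascending (L d).
  by move=> i j leij; apply: leading_coefs_shift (leqnn d) => //; apply: ascI.
have statL d : stationary (L d) by apply: noethR.
have [D statD] : stationary (fun n => L n n).
  apply: noethR => // i j leij.
  by apply: leading_coefs_shift (leij) => //; apply: ascI.
have [N statN] := stationary_uniform D ascL statL.
exists (maxn N D) => n leMn; apply: leading_coefs_eq => //; first exact: ascI.
move=> d; have /andP[leNn leDn] : (N <= n)%N && (D <= n)%N by rewrite -geq_max.
have [ltdD|leDd] := ltnP d D.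
  by move=> a /(statN d n ltdD leNn); apply: ascL; apply: leq_maxl.
move=> a La; have {La} : L D D a.
  apply: (statD (maxn n d)); first by rewrite leq_max leDn.
  apply: leading_coefs_shift La; rewrite ?leq_maxr //; exact/ascI/leq_maxl.
apply: leading_coefs_shift leDd _ => //; apply: ascI; exact: leq_maxr.
Qed.

(** [k[X_0, ..., X_n]] is the image of [k[X_0, ..., X_(n-1)][Y]] under the
    evaluation of [Y] at [X_n]. *)
Theorem noetherian_mpoly (k : fieldType) n : noetherian {mpoly k[n]}.
Proof.
elim: n => [|n IHn].
  apply: (noetherian_surj (q := @mpolyC 0 k)) (@noetherian_field k) => P.
  exists P@_0%MM; apply/mpolyP => m; rewrite mcoeffC.
  by have -> : m = 0%MM by [apply/mnmP; case]; rewrite eqxx mulr1.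
pose X := [tuple 'X_(widen_ord (leqnSn n) i) : {mpoly k[n.+1]} | i < n].
pose q : {rmorphism _ -> _} :=
  horner_eval ('X_ord_max : {mpoly k[n.+1]}) \o map_poly (comp_mpoly X).
apply: (noetherian_surj (q := q)) (hilbert_basis IHn).
move=> P; elim/mpolyind: P => [|c m P _ _ [Q <-]].
  by exists 0; rewrite rmorph0.
suff [M qM] : exists M, q M = 'X_[m].
  exists ((c%:MP)%:P * M + Q); rewrite (rmorphD q) (rmorphM q) qM /= map_polyC /=.
  by rewrite /horner_eval hornerC comp_mpolyC mul_mpolyC.
rewrite mpolyXE_id; exists (
  \prod_(i < n) (('X_i)%:P ^+ m (widen_ord (leqnSn n) i)) * 'X^(m ord_max)).
rewrite (rmorphM q) (rmorph_prod q) big_ord_recr /=; congr (_ * _).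
  apply: eq_bigr => i _; rewrite rmorphXn /= map_polyC /= /horner_eval.
  by rewrite horner_exp hornerC comp_mpolyXU -tnth_nth tnth_mktuple.
by rewrite map_polyXn /horner_eval hornerXn.
Qed.

(** * Open sets and regular functions *)

Section Topology.
Variables (k : closedFieldType) (X : atlas k).
Implicit Types (U V W : set X) (f g : X -> k).

(** The non-vanishing sets of single polynomials are a base of the topology of
    each chart; in this form openness is local, which the existence of a set of
    equations for the complement is not visibly. *)
Lemma zopenP U :
  zopen U <-> forall (i : chart X) x, dom i x -> U x ->
    exists2 P : {mpoly k[dim i]}, P.@[coord i x ord0] != 0 &
      forall y, dom i y -> P.@[coord i y ord0] != 0 -> U y.
Proof.
split=> [openU i x ix Ux|locU i].
  have [S defS] := openU i.
  have [P SP P0] : exists2 P, S P & P.@[coord i x ord0] != 0.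
    apply: contrapT => noP; suff [] : (dom i `&` ~` U) x by [].
    rewrite defS; split=> //= P SP; apply: contrapT => /eqP P0.
    by apply: noP; exists P.
  exists P => // y iy; apply: contraNP => nUy.
  have [_ /(_ P SP) ->//] : (dom i `&` coord i @^-1` zero_locus S) y.
  by rewrite -defS.
exists [set P | forall y, dom i y -> ~ U y -> P.@[coord i y ord0] = 0].
apply/seteqP; split=> [y [iy nUy]|y [iy Sy]]; split=> //.
  by move=> P; apply.
move=> Uy; have [P /eqP P0 PU] := locU i y iy Uy; apply: P0.
by apply: Sy => z iz nUz; apply: contra_notP nUz => /eqP; apply: PU.
Qed.

Lemma zopenC (Z : set X) : zopen (~` Z) <-> zclosed Z.
Proof. by rewrite /zopen setCK. Qed.

Lemma zopenT : zopen [set: X].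
Proof. by apply/zopenP => i x _ _; exists 1; rewrite ?meval1 ?oner_neq0. Qed.

Lemma zopen0 : zopen (set0 : set X).
Proof. by apply/zopenP. Qed.

Lemma zopenI U V : zopen U -> zopen V -> zopen (U `&` V).
Proof.
move=> /zopenP openU /zopenP openV; apply/zopenP => i x ix [Ux Vx].
have [P P0 PU] := openU i x ix Ux; have [Q Q0 QV] := openV i x ix Vx.
exists (P * Q); first by rewrite mevalM mulf_neq0.
move=> y iy; rewrite mevalM mulf_eq0 negb_or => /andP[Py Qy].
by split; [apply: PU | apply: QV].
Qed.

Lemma zopen_local U :
  (forall x, U x -> exists W, [/\ zopen W, W x & W `<=` U]) -> zopen U.
Proof.
move=> locU; apply/zopenP => i x ix Ux.
have [W [/zopenP openW Wx WU]] := locU x Ux.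
by have [P P0 PW] := openW i x ix Wx; exists P => // y iy /(PW y iy)/WU.
Qed.

Lemma zclosed_bigcap I (Z : I -> set X) :
  (forall a, zclosed (Z a)) -> zclosed [set x | forall a, Z a x].
Proof.
move=> closedZ; apply/zopenC/zopen_local => x /= /existsNP[a nZx].
by exists (~` Z a); split=> //; [apply/zopenC | move=> y nZy /(_ a)].
Qed.

Lemma regular_sub U V f : V `<=` U -> regular U f -> regular V f.
Proof.
move=> VU regf i x Vx ix; have [P [Q [Q0 fPQ]]] := regf i x (VU x Vx) ix.
by exists P, Q; split=> // y Vy; apply/fPQ/VU.
Qed.

Lemma regular_ext U f g : regular U f -> (forall x, U x -> f x = g x) ->
  regular U g.
Proof.
move=> regf fg i x Ux ix; have [P [Q [Q0 fPQ]]] := regf i x Ux ix.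
by exists P, Q; split=> // y Uy iy Qy; rewrite -fg // fPQ.
Qed.

(** Multiplying both terms of a fraction by a polynomial that vanishes on the
    chart off [W] forces the new denominator to vanish off [W]. *)
Lemma regular_local U f :
  (forall x, U x -> exists W, [/\ zopen W, W x & regular (U `&` W) f]) ->
  regular U f.
Proof.
move=> locf i x Ux ix; have [W [/zopenP openW Wx regf]] := locf x Ux.
have [R R0 RW] := openW i x ix Wx; have [P [Q [Q0 fPQ]]] := regf i x (conj Ux Wx) ix.
exists (P * R), (Q * R); split=> [|y Uy iy]; first by rewrite mevalM mulf_neq0.
rewrite !mevalM mulf_eq0 negb_or => /andP[Qy Ry].
by rewrite -mulf_div divff // mulr1; apply: fPQ => //; split=> //; apply: RW.
Qed.

Lemma regular_cst U c : regular U (fun=> c).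
Proof.
move=> i x Ux ix; exists c%:MP, 1; rewrite meval1 oner_neq0; split=> // y _ _ _.
by rewrite mevalC meval1 divr1.
Qed.

Lemma regularD U f g :
  regular U f -> regular U g -> regular U (fun x => f x + g x).
Proof.
move=> regf regg i x Ux ix.
have [P [Q [Q0 fPQ]]] := regf i x Ux ix; have [R [S [S0 gRS]]] := regg i x Ux ix.
exists (P * S + R * Q), (Q * S); split=> [|y Uy iy].
  by rewrite mevalM mulf_neq0.
rewrite mevalD !mevalM mulf_eq0 negb_or => /andP[Qy Sy].
by rewrite fPQ // gRS // addf_div.
Qed.

Lemma regularM U f g :
  regular U f -> regular U g -> regular U (fun x => f x * g x).
Proof.
move=> regf regg i x Ux ix.
have [P [Q [Q0 fPQ]]] := regf i x Ux ix; have [R [S [S0 gRS]]] := regg i x Ux ix.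
exists (P * R), (Q * S); split=> [|y Uy iy]; first by rewrite mevalM mulf_neq0.
rewrite !mevalM mulf_eq0 negb_or => /andP[Qy Sy].
by rewrite fPQ // gRS // mulf_div.
Qed.

Lemma regularV U f : (forall x, U x -> f x != 0) ->
  regular U f -> regular U (fun x => (f x)^-1).
Proof.
move=> f0 regf i x Ux ix; have [P [Q [Q0 fPQ]]] := regf i x Ux ix.
have P0 : P.@[coord i x ord0] != 0.
  by have := f0 x Ux; rewrite fPQ //; apply: contraNneq => ->; rewrite mul0r.
exists (Q * Q), (P * Q); split=> [|y Uy iy]; first by rewrite mevalM mulf_neq0.
rewrite !mevalM mulf_eq0 negb_or => /andP[Py Qy].
by rewrite fPQ // invf_div -mulf_div divff // mulr1.
Qed.

Lemma regular_meval U n (F : 'I_n -> X -> k) (P : {mpoly k[n]}) :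
  (forall c, regular U (F c)) -> regular U (fun x => P.@[fun c => F c x]).
Proof.
move=> regF; elim/mpolyind: P => [|c m P _ _ regP].
  by apply: regular_ext (regular_cst 0) _ => x _; rewrite meval0.
apply: (@regular_ext U (fun x => c * \prod_(a < n) F a x ^+ m a +
  P.@[fun a => F a x])); last by move=> x _; rewrite mevalD mevalZ mevalX.
apply: regularD => //; apply: regularM; first exact: regular_cst.
elim: (index_enum _) => [|a s IHs].
  by apply: regular_ext (regular_cst 1) _ => x _; rewrite big_nil.
apply: (@regular_ext U (fun x => F a x ^+ m a * \prod_(b <- s) F b x ^+ m b)); last first.
  by move=> x _; rewrite big_cons.
apply: regularM => //; elim: (m a) => [|d IHd]; first exact: regular_cst.
by apply: regular_ext (regularM (regF a) IHd) _ => x _; rewrite exprS.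
Qed.

(** Where [f = P / Q] and [R] cuts out a neighbourhood inside [U], the product
    [P Q R] is non-zero only at points of [U] where [f] is non-zero. *)
Lemma zopen_neq0 U f : zopen U -> regular U f ->
  zopen (U `&` [set x | f x != 0]).
Proof.
move=> /zopenP openU regf; apply/zopenP => i x ix [Ux fx].
have [R R0 RU] := openU i x ix Ux; have [P [Q [Q0 fPQ]]] := regf i x Ux ix.
have P0 : P.@[coord i x ord0] != 0.
  by move: fx => /=; rewrite fPQ //; apply: contraNneq => ->; rewrite mul0r.
exists (P * Q * R); first by rewrite !mevalM !mulf_neq0.
move=> y iy; rewrite !mevalM !mulf_eq0 !negb_or -andbA => /and3P[Py Qy Ry].
have Uy := RU y iy Ry; split=> //=.
by rewrite fPQ // mulf_neq0 // invr_eq0.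
Qed.

Lemma zclosed_set1 (x : X) : prevariety X -> zclosed [set x].
Proof.
move=> [_ injX _ openX _]; apply/zopenC/zopenP => i y iy /= nyx.
have [ix|nix] := pselect (dom i x); last first.
  exists 1; first by rewrite meval1 oner_neq0.
  by move=> z iz _ eqzx; apply: nix; rewrite -eqzx.
have [c nc] : exists c, coord i y ord0 c != coord i x ord0 c.
  apply: contrapT => noc; apply: nyx; apply: (injX i); rewrite ?inE //.
  apply/rowP => c; apply: contrapT => /eqP nc; apply: noc; exists c.
  exact: nc.
exists ('X_c - (coord i x ord0 c)%:MP).
  by rewrite mevalB mevalC mevalXU subr_eq0.
by move=> z iz; rewrite mevalB mevalC mevalXU subr_eq0 => /eqP + eqzx; rewrite eqzx.
Qed.

(** Intersections of finitely many non-empty open sets are non-empty. *)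
Lemma irreducible_cover n (Z : nat -> set X) : irreducible X ->
  (forall a, zclosed (Z a)) ->
  (forall x, exists2 a, (a < n)%N & Z a x) -> exists a, Z a = setT.
Proof.
move=> [[x0 _] irrX] closedZ coverZ; apply: contrapT => noZ.
suff [_ [x Zx]] : zopen [set x | forall a, (a < n)%N -> ~ Z a x] /\
    exists x, forall a, (a < n)%N -> ~ Z a x.
  by have [a ltan] := coverZ x; apply: Zx.
move: {coverZ}n; elim=> [|n [openn [x Zx]]].
  split; last by exists x0.
  by rewrite (_ : mkset _ = setT) //; [apply: zopenT | apply/seteqP; split].
have eqU : [set x | forall a, (a < n.+1)%N -> ~ Z a x] =
    [set x | forall a, (a < n)%N -> ~ Z a x] `&` ~` Z n.
  apply/seteqP; split=> [y Zy|y [Zy nZy] a /=].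
    by split=> [a ltan|]; apply: Zy; rewrite // ltnS ltnW.
  by rewrite ltnS leq_eqVlt => /predU1P[->|/Zy].
split; first by rewrite eqU; apply: zopenI => //; apply/zopenC.
apply: contrapT => nox.
have [|||ZT|ZT] := irrX (~` [set x | forall a, (a < n)%N -> ~ Z a x]) (Z n).
- exact: openn.
- exact: closedZ.
- apply/seteqP; split=> // y _; apply: contrapT => /not_orP[/contrapT Zy nZy].
  apply: nox; exists y.
  by rewrite -/([set x | forall a, (a < n.+1)%N -> ~ Z a x] y) eqU.
- have : (~` [set x | forall a, (a < n)%N -> ~ Z a x]) x by rewrite ZT.
  by apply.
- by apply: noZ; exists n.
Qed.

End Topology.

(** * Morphisms and products *)

Section Morphisms.
Variable k : closedFieldType.
Implicit Types (X Y Z : atlas k).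

Lemma zclosed_preimage X Y (f : X -> Y) (Z : set Y) :
  zmorphism f -> zclosed Z -> zclosed (f @^-1` Z).
Proof. by move=> /[swap] /zopenC openZ /(_ _ openZ)[/zopenC]. Qed.

Lemma zmorphism_comp X Y Z (f : X -> Y) (g : Y -> Z) :
  zmorphism f -> zmorphism g -> zmorphism (g \o f).
Proof.
move=> morf morg V openV; have [openU regU] := morg V openV.
have [openW regW] := morf _ openU; split=> // phi regphi.
exact/(regW (phi \o g))/regU.
Qed.

Lemma zmorphism_id X : zmorphism (@id X).
Proof. by []. Qed.

Lemma zmorphism_cst X Y (y : Y) : zmorphism (fun _ : X => y).
Proof.
move=> V openV; split=> [|phi _]; last exact: regular_cst.
have [Vy|nVy] := pselect (V y).
  by rewrite (_ : _ @^-1` V = setT); [apply: zopenT | apply/seteqP; split].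
by rewrite (_ : _ @^-1` V = set0); [apply: zopen0 | apply/seteqP; split].
Qed.

Lemma zmorphism_fst X Y : zmorphism (fst : prod_atlas X Y -> X).
Proof.
move=> V /zopenP openV.
pose lift (i : chart X) (j : chart Y) (P : {mpoly k[dim i]}) : {mpoly k[dim i + dim j]} :=
  P \mPo [tuple 'X_(lshift (dim j) c) | c < dim i].
have liftE (i : chart X) (j : chart Y) P (z : prod_atlas X Y) :
    (lift i j P).@[coord ((i, j) : chart (prod_atlas X Y)) z ord0] =
    P.@[coord i z.1 ord0].
  rewrite comp_mpoly_meval; congr meval; apply/funext => c.
  by rewrite tnth_mktuple mevalXU row_mxEl.
split=> [|phi regphi].
  apply/zopenP => -[i j] z [iz jz] Vz; have [P P0 PV] := openV i z.1 iz Vz.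
  by exists (lift i j P) => [|y [iy _]]; rewrite liftE //; apply: PV.
move=> [i j] z Vz [iz jz]; have [P [Q [Q0 phiPQ]]] := regphi i z.1 Vz iz.
exists (lift i j P), (lift i j Q); rewrite liftE; split=> // y Vy [iy _].
by rewrite !liftE; apply: phiPQ.
Qed.

Lemma zmorphism_snd X Y : zmorphism (snd : prod_atlas X Y -> Y).
Proof.
move=> V /zopenP openV.
pose lift (i : chart X) (j : chart Y) (P : {mpoly k[dim j]}) : {mpoly k[dim i + dim j]} :=
  P \mPo [tuple 'X_(rshift (dim i) c) | c < dim j].
have liftE (i : chart X) (j : chart Y) P (z : prod_atlas X Y) :
    (lift i j P).@[coord ((i, j) : chart (prod_atlas X Y)) z ord0] =
    P.@[coord j z.2 ord0].
  rewrite comp_mpoly_meval; congr meval; apply/funext => c.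
  by rewrite tnth_mktuple mevalXU row_mxEr.
split=> [|phi regphi].
  apply/zopenP => -[i j] z [iz jz] Vz; have [P P0 PV] := openV j z.2 jz Vz.
  by exists (lift i j P) => [|y [_ jy]]; rewrite liftE //; apply: PV.
move=> [i j] z Vz [iz jz]; have [P [Q [Q0 phiPQ]]] := regphi j z.2 Vz jz.
exists (lift i j P), (lift i j Q); rewrite liftE; split=> // y Vy [_ jy].
by rewrite !liftE; apply: phiPQ.
Qed.

(** An open set or a regular function of the product is given near a point by
    polynomials in the coordinates of both factors, and these coordinates
    composed with [f] and [g] are regular. *)
Lemma zmorphism_pair Z X Y (f : Z -> X) (g : Z -> Y) :
  prevariety X -> prevariety Y -> zmorphism f -> zmorphism g ->
  zmorphism (fun z => (f z, g z) : prod_atlas X Y).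
Proof.
move=> [covX _ _ openX regX] [covY _ _ openY regY] morf morg V openV.
pose W (i : chart X) (j : chart Y) : set Z := f @^-1` dom i `&` g @^-1` dom j.
have openW i j : zopen (W i j).
  by apply: zopenI; [have [] := morf _ (openX i) | have [] := morg _ (openY j)].
pose h (i : chart X) (j : chart Y) z :=
  coord ((i, j) : chart (prod_atlas X Y)) (f z, g z) ord0.
have regW i j (P : {mpoly k[dim i + dim j]}) :
    regular (W i j) (fun z => P.@[h i j z]).
  apply: (@regular_meval _ _ (W i j) _ (fun c z => h i j z c)) => c.
  rewrite /h /=; case: (split_ordP c) => a ->.
    apply: (@regular_ext _ _ _ (fun z => coord i (f z) ord0 a)) => [|z _].
      apply: (@regular_sub _ _ (f @^-1` dom i)); first by move=> z [].
      by have [_ /(_ _ (regX i a))] := morf _ (openX i).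
    by rewrite row_mxEl.
  apply: (@regular_ext _ _ _ (fun z => coord j (g z) ord0 a)) => [|z _].
    apply: (@regular_sub _ _ (g @^-1` dom j)); first by move=> z [].
    by have [_ /(_ _ (regY j a))] := morg _ (openY j).
  by rewrite row_mxEr.
split=> [|phi regphi].
  apply: zopen_local => z Vz.
  have [i iz] := covX (f z); have [j jz] := covY (g z).
  have /zopenP/(_ (i, j) (f z, g z) (conj iz jz) Vz)[P P0 PV] := openV.
  exists (W i j `&` [set z | P.@[h i j z] != 0]); split=> //.
    exact/zopen_neq0/regW.
  by move=> y [[iy jy] Py]; apply: (PV (f y, g y)).
apply: regular_local => z Vz.
have [i iz] := covX (f z); have [j jz] := covY (g z).
have [P [Q [Q0 phiPQ]]] := regphi (i, j) (f z, g z) Vz (conj iz jz).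
exists (W i j `&` [set z | Q.@[h i j z] != 0]); split=> //.
  exact/zopen_neq0/regW.
apply: (@regular_ext _ _ _ (fun z => P.@[h i j z] / Q.@[h i j z])).
  apply: regularM; first by apply: regular_sub (regW i j P) => y [_ []].
  apply: regularV; first by move=> y [_ []].
  by apply: regular_sub (regW i j Q) => y [_ []].
by move=> y [Vy [[iy jy] Qy]]; rewrite /= (phiPQ (f y, g y)).
Qed.

Lemma zclosed_eq Z X (f g : Z -> X) :
  variety X -> zmorphism f -> zmorphism g -> zclosed [set z | f z = g z].
Proof.
move=> [preX _ sepX] morf morg.
exact: (zclosed_preimage (zmorphism_pair preX preX morf morg) sepX).
Qed.

(** The image is the projection of the graph, which is closed as the target is
    separated. *)
Lemma zclosed_range X Y (f : X -> Y) :
  complete X -> variety Y -> zmorphism f -> zclosed (range f).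
Proof.
move=> complX varY morf.
suff -> : range f = snd @` [set xy : prod_atlas X Y | f xy.1 = xy.2].
  apply: complX => //; apply: (@zclosed_eq (prod_atlas X Y)) => //.
    exact: (zmorphism_comp (@zmorphism_fst X Y) morf).
  exact: zmorphism_snd.
apply/seteqP; split=> [_ [x _ <-]|_ [[x y] /= <- <-]]; last by exists x.
by exists (x, f x).
Qed.

(** The finitely many fibres are closed and cover an irreducible space. *)
Lemma zmorphism_finite_cst X Y (f : X -> Y) n (s : nat -> Y) (x0 : X) :
  irreducible X -> prevariety Y -> zmorphism f ->
  (forall x, exists2 a, (a < n)%N & f x = s a) -> forall x, f x = f x0.
Proof.
move=> irrX preY morf cov.
have [||a fa x] := @irreducible_cover _ X n (fun a => f @^-1` [set s a]) irrX.
- by move=> a; apply: zclosed_preimage => //; apply: zclosed_set1.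
- exact: cov.
have inT y : (f @^-1` [set s a]) y by rewrite fa.
by rewrite [LHS]inT [RHS]inT.
Qed.

End Morphisms.

(** * The affine line and regular functions on complete varieties *)

Section AffineLine.
Variable k : closedFieldType.

Definition affine_line : atlas k :=
  @Atlas k k unit (fun=> 1%N) (fun=> setT) (fun _ t => const_mx t).

Lemma regular_affine_line : regular setT (id : affine_line -> k).
Proof.
move=> i t _ _; exists 'X_ord0, 1; rewrite meval1 oner_neq0; split=> // u _ _ _.
by rewrite mevalXU meval1 mxE divr1.
Qed.

Lemma prevariety_affine_line : prevariety affine_line.
Proof.
split=> [t||i|i|i c].
- by exists tt.
- by move=> i t u _ _ /rowP/(_ ord0); rewrite !mxE.
- exists set0; apply/seteqP; split=> [v _ P []|v _].
  exists ((v : 'rV_1) ord0 ord0) => //=.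
  by apply/rowP => j; rewrite mxE (ord1 (j : 'I_1)).
- exact: zopenT.
- by apply: regular_ext regular_affine_line _ => t _; rewrite mxE.
Qed.

(** Proper closed subsets of the line lie in the zero set of one non-zero
    polynomial; in particular they are finite. *)
Lemma zclosed_affine_line (Z : set affine_line) t0 : zclosed Z -> ~ Z t0 ->
  exists2 p : {poly k}, p != 0 & forall t, Z t -> root p t.
Proof.
move=> /zopenC/zopenP openZ nZt0.
have [P P0 PZ] := openZ tt t0 I nZt0.
have [p pP] : exists p : {poly k}, forall t, P.@[fun=> t] = p.[t].
  elim/mpolyind: {P0 PZ}P => [|c m P _ _ [p pP]].
    by exists 0 => t; rewrite meval0 horner0.
  exists (c *: 'X^(m ord0) + p) => t.
  by rewrite mevalD mevalZ mevalX big_ord1 pP !hornerE.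
have PE t : P.@[(const_mx t : 'rV_1) ord0] = p.[t].
  by rewrite -pP; congr meval; apply/funext => c; rewrite mxE.
exists p => [|t].
  by move: P0; rewrite PE; apply: contraNneq => ->; rewrite horner0.
by apply: contraPT; rewrite rootE -PE; apply: (PZ t I).
Qed.

Lemma irreducible_affine_line : irreducible affine_line.
Proof.
split=> [|Y Z closedY closedZ YZ]; first by exists 0.
have [YT|/existsNP[y nYy]] := pselect (forall y, Y y).
  by left; apply/seteqP; split=> y _; first exact: I.
have [ZT|/existsNP[z nZz]] := pselect (forall z, Z z).
  by right; apply/seteqP; split=> z _; first exact: I.
have [p p0 rootp] := zclosed_affine_line closedY nYy.
have [q q0 rootq] := zclosed_affine_line closedZ nZz.
have /closed_nonrootP[t] : p * q != 0 by rewrite mulf_neq0.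
have : (Y `|` Z) t by rewrite YZ.
by rewrite rootM => -[/rootp->|/rootq->]; rewrite ?orbT.
Qed.

Lemma zclosed_regular_eq0 (X : atlas k) (f : X -> k) :
  regular setT f -> zclosed [set x | f x = 0].
Proof.
move=> /(zopen_neq0 (@zopenT _ X)) openf; apply/zopenC.
suff -> : ~` [set x | f x = 0] = setT `&` [set x | f x != 0] by [].
by apply/seteqP; split=> [x /= /eqP|x [_ /eqP]].
Qed.

Lemma regular_fst (X Y : atlas k) (f : X -> k) :
  regular setT f -> regular setT (fun z : prod_atlas X Y => f z.1).
Proof. by have [_ /(_ f)] := @zmorphism_fst k X Y _ (@zopenT _ X). Qed.

Lemma regular_snd (X Y : atlas k) (f : Y -> k) :
  regular setT f -> regular setT (fun z : prod_atlas X Y => f z.2).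
Proof. by have [_ /(_ f)] := @zmorphism_snd k X Y _ (@zopenT _ Y). Qed.

Lemma variety_affine_line : variety affine_line.
Proof.
split; [exact: prevariety_affine_line | exact: irreducible_affine_line |].
rewrite /separated (_ : [set _ | _] = [set z | z.1 + (-1) * z.2 = 0]).
  apply: zclosed_regular_eq0; apply: regularD.
    exact: (@regular_fst affine_line affine_line id regular_affine_line).
  apply: regularM; first exact: regular_cst.
  exact: (@regular_snd affine_line affine_line id regular_affine_line).
apply/seteqP; split=> z /=; rewrite mulN1r; first by move=> ->; rewrite subrr.
by move=> /eqP; rewrite subr_eq0 => /eqP.
Qed.

(** The projection to the line of [f x * t = 1] is closed and misses [0], so it
    is finite: [f] takes finitely many values, and [X] is irreducible. *)
Theorem complete_regular_cst (X : atlas k) (f : X -> k) :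
  irreducible X -> complete X -> regular setT f -> forall x y, f x = f y.
Proof.
move=> irrX complX regf x y.
pose H := [set z : prod_atlas X affine_line | f z.1 * z.2 + -1 = 0].
have closedH : zclosed H.
  apply: zclosed_regular_eq0; apply: regularD; last exact: regular_cst.
  apply: regularM; first exact: regular_fst.
  exact: (@regular_snd X affine_line id regular_affine_line).
have n0 : ~ (snd @` H) 0.
  move=> [[z t] + /= t0]; rewrite /H /= t0 mulr0 add0r => /eqP.
  by rewrite oppr_eq0 oner_eq0.
have [p p0 rootp] := zclosed_affine_line (complX _ variety_affine_line _ closedH) n0.
have [s ps] := closed_field_poly_normal p.
pose v := 0 :: map GRing.inv s.
have fv z : f z \in v.
  have [->|fz0] := eqVneq (f z) 0; first by rewrite mem_head.
  rewrite inE; apply/orP; right; apply/mapP; exists (f z)^-1; last by rewrite invrK.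
  have := rootp (f z)^-1; rewrite ps rootZ ?lead_coef_eq0 // root_prod_XsubC.
  by apply; exists (z, (f z)^-1); rewrite // /H /= divff // subrr.
have [||a fa] :=
  @irreducible_cover _ X (size v) (fun a => [set z | f z + - nth 0 v a = 0]) irrX.
- move=> a; apply: zclosed_regular_eq0; apply: regularD => //.
  exact: regular_cst.
- move=> z; exists (index (f z) v); first by rewrite index_mem.
  by rewrite /= nth_index // subrr.
have feq z : f z = nth 0 v a.
  apply/eqP; rewrite -subr_eq0; apply/eqP.
  by rewrite -[_ = _]/([set z | f z + - nth 0 v a = 0] z) fa.
by rewrite !feq.
Qed.

End AffineLine.

(** * Commutativity of abelian varieties *)

Declare Scope av_scope.

Section Commutativity.
Variables (k : closedFieldType) (A : abelian_variety k).

Local Notation "x + y" := (av_add x y) : av_scope.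
Local Notation "- x" := (av_opp x) : av_scope.
Local Notation "x - y" := (av_add x (av_opp y)) : av_scope.
Local Notation "0" := (av_zero A) : av_scope.
Local Open Scope av_scope.

Lemma av_addNr (x : A) : x - x = 0.
Proof.
rewrite -[LHS]av_add0 -{1}(av_addN (- x)) -av_addA.
by rewrite (av_addA (- x)) av_addN av_add0 av_addN.
Qed.

Lemma av_addr0 (x : A) : x + 0 = x.
Proof. by rewrite -(av_addN x) av_addA av_addNr av_add0. Qed.

Lemma zmorphism_add (X : atlas k) (f g : X -> A) :
  zmorphism f -> zmorphism g -> zmorphism (fun x => f x + g x).
Proof.
have [preA _ _] := av_variety A => morf morg.
exact: (zmorphism_comp (zmorphism_pair preA preA morf morg) (@av_add_morph k A)).
Qed.

Lemma zmorphism_opp (X : atlas k) (f : X -> A) :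
  zmorphism f -> zmorphism (fun x => - f x).
Proof. by move=> morf; apply: (zmorphism_comp morf (@av_opp_morph k A)). Qed.

(** Rigidity lemma for the commutator [c].  If [y] is not in the closed set [W]
    of those [y] for which some [c (x, y)] leaves the chart of [0], then each
    coordinate of [c (x, y)] is a regular function of [x], hence constant, and
    [c (x, y) = c (0, y) = 0].  So [A] is the union of [W] and the closed set [C]
    of central points, and [W] does not contain [0]. *)
Theorem av_addC : commutative (@av_add k A).
Proof.
have [preA irrA sepA] := av_variety A; have [covA injA _ openA regA] := preA.
pose AA : atlas k := prod_atlas A A.
pose c (z : AA) : A := z.1 + z.2 - z.1 - z.2.
have mor1 := @zmorphism_fst k A A; have mor2 := @zmorphism_snd k A A.
have morc : zmorphism c.
  exact: (zmorphism_add (zmorphism_add (zmorphism_add mor1 mor2)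
    (zmorphism_opp mor1)) (zmorphism_opp mor2)).
have c0r x : c (x, 0) = 0.
  by rewrite /c /= av_addr0 av_addNr av_add0 -[LHS]av_addr0 av_addN.
have c0l y : c (0, y) = 0.
  by rewrite /c /= av_add0 -[y + _]av_addr0 -(av_addA y) av_addN av_addr0 av_addNr.
have [i i0] := covA 0.
pose W : set A := snd @` (c @^-1` ~` dom i).
have closedW : zclosed W.
  apply: (av_complete (av_variety A)); apply: zclosed_preimage => //.
  exact: openA.
pose C : set A := [set y | forall x, c (x, y) = 0].
have pairl x : zmorphism (fun y : A => (x, y) : AA).
  by apply: zmorphism_pair => //; apply: zmorphism_cst.
have pairr y : zmorphism (fun x : A => (x, y) : AA).
  by apply: zmorphism_pair => //; apply: zmorphism_cst.
have closedC : zclosed C.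
  apply: zclosed_bigcap => x.
  apply: (@zclosed_eq _ A A (fun y => c (x, y)) (fun=> 0)) => //.
  + exact: (zmorphism_comp (pairl x) morc).
  + exact: zmorphism_cst.
have CW : C `|` W = setT.
  apply/seteqP; split=> // y _; have [?|nWy] := pselect (W y); [by right|left].
  move=> x; have cU z : dom i (c (z, y)).
    by apply: contrapT => nU; apply: nWy; exists (z, y).
  rewrite -(c0l y); apply: (injA i); rewrite ?inE //; apply/rowP => a.
  apply: (complete_regular_cst (f := fun z => coord i (c (z, y)) ord0 a)) irrA _ _ _ _.
    exact: av_complete.
  have [_ /(_ _ (regA i a))] := zmorphism_comp (pairr y) morc (openA i).
  by apply: regular_sub => z _; apply: cU.
have [CT|WT] := irrA.2 C W closedC closedW CW; last first.
  have : W 0 by rewrite WT.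
  by move=> [[x y] /= + y0]; rewrite y0 c0r.
move=> x y; have : C y by rewrite CT.
move=> /(_ x); rewrite /c /= => cxy.
rewrite -[RHS]av_add0 -cxy -!av_addA (av_addA (- y)) av_addN av_add0.
by rewrite av_addN av_addr0.
Qed.

End Commutativity.

(** * Integer polynomials in an endomorphism *)

Section PolynomialAction.
Variables (M : zmodType) (g : {additive M -> M}).
Implicit Types (P Q : {poly int}) (x y : M).

(** The value at [g] of an integer polynomial, in the endomorphism ring of
    [M]. *)
Definition poly_act P x : M := \sum_(i < size P) iter i g x *~ P`_i.

Lemma poly_actE n P x : (size P <= n)%N ->
  poly_act P x = \sum_(i < n) iter i g x *~ P`_i.
Proof.
move=> sPn; rewrite /poly_act (big_ord_widen n (fun i => iter i g x *~ P`_i) sPn).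
rewrite big_mkcond; apply: eq_bigr => i _; case: ltnP => // sPi.
by rewrite nth_default ?mulr0z.
Qed.

Lemma poly_actDl P Q x : poly_act (P + Q) x = poly_act P x + poly_act Q x.
Proof.
rewrite (poly_actE x (size_polyD P Q)) (poly_actE x (leq_maxl _ (size Q))).
rewrite (poly_actE x (leq_maxr (size P) _)) -big_split.
by apply: eq_bigr => i _; rewrite coefD mulrzDr.
Qed.

Lemma poly_actDr P : {morph poly_act P : x y / x + y}.
Proof.
move=> x y; rewrite -big_split; apply: eq_bigr => i _ /=; rewrite -mulrzDl.
by congr (_ *~ _); elim: (val i) => //= n ->; rewrite raddfD.
Qed.

Lemma poly_act0r P : poly_act P 0 = 0.
Proof. by apply: (addrI (poly_act P 0)); rewrite -poly_actDr !addr0. Qed.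

Lemma poly_actMn P x n : poly_act P (x *+ n) = poly_act P x *+ n.
Proof.
by elim: n => [|n IHn]; rewrite ?mulr0n ?poly_act0r // !mulrS poly_actDr IHn.
Qed.

Lemma poly_actZ c P x : poly_act (c%:P * P) x = poly_act P x *~ c.
Proof.
rewrite mul_polyC (poly_actE x (size_scale_leq c P)) mulrz_suml.
by apply: eq_bigr => i _; rewrite coefZ mulrC mulrzA.
Qed.

Lemma poly_actC c x : poly_act c%:P x = x *~ c.
Proof. by rewrite (poly_actE x (size_polyC_leq1 c)) big_ord1 coefC. Qed.

Lemma poly_actMX P x : poly_act (P * 'X) x = poly_act P (g x).
Proof.
have sPX : (size (P * 'X)%R <= (size P).+1)%N.
  by rewrite (leq_trans (size_polyMleq _ _)) // size_polyX addn2.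
rewrite (poly_actE x sPX) big_ord_recl coefMX mulr0z add0r.
by apply: eq_bigr => i _; rewrite coefMX /= -iterS iterSr.
Qed.

Lemma poly_actM P Q x : poly_act (P * Q) x = poly_act P (poly_act Q x).
Proof.
elim/poly_ind: P Q x => [|P c IHP] Q x.
  by rewrite mul0r -polyC0 !poly_actC !mulr0z.
rewrite mulrDl !poly_actDl poly_actZ poly_actC; congr (_ + _).
rewrite -mulrA IHP poly_actMX; congr poly_act.
rewrite mulrC poly_actMX raddf_sum; apply: eq_bigr => i _.
by rewrite -iterSr /= raddfMz.
Qed.

Lemma poly_actXn n x : poly_act 'X^n x = iter n g x.
Proof.
elim: n x => [|n IHn] x; first by rewrite expr0 poly_actC mulr1z.
by rewrite exprSr poly_actMX IHn iterSr.
Qed.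

Lemma poly_act_sum (I : Type) (s : seq I) (F : I -> {poly int}) x :
  poly_act (\sum_(i <- s) F i) x = \sum_(i <- s) poly_act (F i) x.
Proof.
elim: s => [|i s IHs]; first by rewrite !big_nil -polyC0 poly_actC mulr0z.
by rewrite !big_cons poly_actDl IHs.
Qed.

Lemma poly_act_XsubC1 n x :
  poly_act (('X - 1) ^+ n) x = iter n (fun y => g y - y) x.
Proof.
elim: n x => [|n IHn] x; first by rewrite expr0 poly_actC mulr1z.
rewrite exprSr poly_actM IHn iterSr -['X]expr1 -polyCN poly_actDl poly_actXn.
by rewrite poly_actC mulrN1z.
Qed.

End PolynomialAction.

(** Modulo [l], Frobenius gives [(X - 1)^q = X^q - 1] for [q = l ^ r], so
    [Phi (X - 1)^q = X^(q l) - 1 = (X - 1)^(q l)] where [Phi] is the sum on the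
    left: so [Phi] is a power of [X - 1].  Evaluating at [1] gives [l = l U(1)]. *)
Lemma cyclotomic_congr (l r : nat) : prime l ->
  exists2 U : {poly int}, U.[1] = 1 &
    \sum_(i < l) 'X^(i * l ^ r) = ('X - 1) ^+ ((l - 1) * l ^ r) + U *+ l.
Proof.
move=> l_pr; set q := (l ^ r)%N; set d := ((l - 1) * q)%N.
have l_gt1 := prime_gt1 l_pr; have l_gt0 := prime_gt0 l_pr.
have q_gt0 : (0 < q)%N by rewrite expn_gt0 l_gt0.
have d_gt0 : (0 < d)%N by rewrite muln_gt0 subn_gt0 l_gt1.
set Phi := \sum_(i < l) _; pose D : {poly int} := Phi - ('X - 1) ^+ d.
have chl : l \in [pchar {poly 'F_l}] by rewrite pchar_poly pchar_Fp.
have D0 : map_poly (intr : int -> 'F_l) D = 0.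
  have frob (Y : {poly 'F_l}) n : l.-nat n -> (Y - 1) ^+ n = Y ^+ n - 1.
    rewrite -(eq_pnat _ (pcharf_eq chl)) => chn.
    by rewrite -[in RHS](subrK 1 Y) [in RHS]exprDn_pchar // expr1n addrK.
  have Xq : ('X - 1 : {poly 'F_l}) ^+ q = 'X^q - 1.
    by rewrite frob // pnatX pnat_id.
  have Xq0 : ('X - 1 : {poly 'F_l}) ^+ q != 0.
    by rewrite expf_neq0 // -polyC1 polyXsubC_eq0.
  rewrite rmorphB rmorphXn rmorphB /= map_polyX rmorph1 rmorph_sum /=.
  apply/eqP; rewrite subr_eq0 -(inj_eq (mulfI Xq0)) -exprD; apply/eqP.
  have -> : (q + d = q * l)%N by rewrite addnC -mulSnr subn1 prednK // mulnC.
  rewrite exprM Xq; under eq_bigr do rewrite map_polyXn mulnC exprM.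
  rewrite -subrX1.
  by rewrite frob // pnat_id.
have dvD i : (l %| D`_i)%Z.
  by rewrite (dvdz_pcharf (pchar_Fp l_pr)) -coef_map D0 coef0.
pose U := \poly_(i < size D) (divz D`_i l).
have DE : D = U *+ l.
  apply/polyP => i; rewrite coefMn coef_poly; case: ltnP => [_|sDi].
    by rewrite -mulr_natr natz divzK.
  by rewrite mul0rn nth_default.
exists U; last by rewrite -DE /D addrC subrK.
have : D.[1] = l%:R.
  rewrite !hornerE horner_sum subrr expr0n gtn_eqF // subr0.
  under eq_bigr do rewrite hornerXn expr1n.
  by rewrite sumr_const card_ord.
rewrite DE hornerMn -mulr_natr => /eqP; rewrite -subr_eq0 -{2}[l%:R]mul1r -mulrBl.
by rewrite mulf_eq0 subr_eq0 Num.Theory.pnatr_eq0 gtn_eqF // orbF => /eqP.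
Qed.

(** With [f := g - 1] and the [U] of [cyclotomic_congr], [f^d = - l U(g)], which
    gives one direction.  Conversely, if [f^d x = 0] then [y := l x] is killed by
    [U(g)] and by [f^d]; as [1 - U] is a multiple [V (X - 1)], we get
    [y = (1 - U)(g)^d y = V(g)^d f^d y = 0]. *)
Lemma torsion_iter_kernel (M : zmodType) (g : {additive M -> M}) (l r : nat) x :
  prime l -> (forall y, \sum_(i < l) iter (i * l ^ r) g y = 0) ->
  x *+ l = 0 <-> iter ((l - 1) * l ^ r) (fun y => g y - y) x = 0.
Proof.
move=> l_pr Phi0; have [U U1 PhiE] := cyclotomic_congr r l_pr.
set d := (_ * _)%N in PhiE *.
have actd y : poly_act g (('X - 1) ^+ d) y = - poly_act g U (y *+ l).
  apply/eqP; rewrite -addr_eq0 poly_actMn pmulrn -poly_actZ -poly_actDl.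
  have -> : (l : int)%:P * U = U *+ l.
    by apply/polyP => i; rewrite coefCM coefMn -mulr_natl natz.
  rewrite -PhiE poly_act_sum.
  by under eq_bigr do rewrite poly_actXn; rewrite Phi0.
rewrite -poly_act_XsubC1; split=> [xl|].
  by rewrite actd xl poly_act0r oppr0.
set y := x *+ l => actx0.
have Uy : poly_act g U y = 0 by apply/eqP; rewrite -oppr_eq0 -actd actx0.
have actyd : poly_act g (('X - 1) ^+ d) y = 0 by rewrite poly_actMn actx0 mul0rn.
have /factor_theorem[V VE] : root (1 - U) 1 by rewrite rootE !hornerE U1 subrr.
have fix1 : poly_act g (1 - U) y = y.
  rewrite poly_actDl -[- U]mulN1r -polyCN poly_actZ Uy mul0rz addr0.
  by rewrite poly_actC mulr1z.
have fixy n : poly_act g ((1 - U) ^+ n) y = y.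
  elim: n => [|n IHn]; first by rewrite expr0 poly_actC mulr1z.
  by rewrite exprSr poly_actM fix1 IHn.
by rewrite -(fixy d) VE exprMn poly_actM actyd poly_act0r.
Qed.

(** * Counting kernels *)

Section Kernels.
Variables (M : zmodType) (f : {additive M -> M}).

(** [f] maps the kernel of [f^(n+1)] to the kernel of [f^n] with fibres that are
    cosets of the kernel of [f]. *)
Lemma iter_kernel_finite (s : seq M) n : (forall x, f x = 0 -> x \in s) ->
  exists t : seq M, forall x, iter n f x = 0 -> x \in t.
Proof.
move=> kers.
(* A section of [f] over its image; off the image [0] is a default value. *)
have /choice[h fh] : forall y, exists x, forall z, f z = y -> f x = y.
  move=> y; have [[z fz]|nz] := pselect (exists z, f z = y); first by exists z.
  by exists 0 => z fz; case: nz; exists z.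
elim: n => [|n [t kert]]; first by exists [:: 0] => x /= ->; rewrite inE.
exists [seq u + h v | u <- s, v <- t] => x; rewrite iterSr => /kert ft.
apply/allpairsP; exists (x - h (f x), f x); split=> //=; last by rewrite subrK.
by apply: kers; rewrite raddfB /= (fh (f x) x) // subrr.
Qed.

(** When [f] is surjective, all the fibres of the map from the kernel of
    [f^(n+1)] to the kernel of [f^n] are non-empty, so cardinalities multiply. *)
Lemma iter_kernel_card (s : seq M) n : (forall y, exists x, f x = y) ->
    uniq s -> (forall x, x \in s = (f x == 0)) ->
  exists t : seq M,
    [/\ uniq t, size t = (size s ^ n)%N & forall x, x \in t = (iter n f x == 0)].
Proof.
move=> /choice[h fh] uniqs mems.
elim: n => [|n [t [uniqt sizet memt]]].
  by exists [:: 0]; split=> // x; rewrite inE.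
have fE u v : u \in s -> f (u + h v) = v.
  by rewrite mems raddfD /= fh => /eqP->; rewrite add0r.
exists [seq u + h v | u <- s, v <- t]; split.
- apply: allpairs_uniq => // -[u v] [u' v'] /allpairsP[[a b] [sa tb [-> ->]]].
  move=> /allpairsP[[a' b'] [sa' tb' [-> ->]]] /= eq_uv.
  have eq_b : b = b' by rewrite -(fE a b sa) eq_uv fE.
  by move: eq_uv; rewrite eq_b => /addIr->.
- by rewrite size_allpairs sizet expnS.
move=> x; rewrite iterSr -memt; apply/allpairsP/idP.
  by move=> [[u v] [su tv ->]]; rewrite fE.
move=> tfx; exists (x - h (f x), f x); split=> //=; last by rewrite subrK.
by rewrite mems raddfB /= fh subrr.
Qed.

End Kernels.

(** By Cauchy's theorem every prime divisor of the order is the order of an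
    element, hence equal to [l]. *)
Lemma exponent_prime_card (M : zmodType) (s : seq M) (l : nat) :
    prime l -> uniq s -> 0 \in s ->
    {in s &, forall x y, x + y \in s} -> {in s, forall x, - x \in s} ->
    {in s, forall x, x *+ l = 0} ->
  exists m, size s = (l ^ m)%N.
Proof.
move=> l_pr uniqs s0 sD sN sl.
pose S := seq_sub s.
pose add (x y : S) : S := SeqSub (sD _ _ (ssvalP x) (ssvalP y)).
pose opp (x : S) : S := SeqSub (sN _ (ssvalP x)).
have addA : associative add by move=> x y z; apply/val_inj/addrA.
have add0 : left_id (SeqSub s0) add by move=> x; apply/val_inj/add0r.
have addN : left_inverse (SeqSub s0) opp add by move=> x; apply/val_inj/addNr.
(* The points of [s], written multiplicatively, to use Cauchy's theorem. *)
pose G : finGroupType := HB.pack S (Finite_isGroup.Build S addA add0 addN).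
have expE (x : G) n : ssval (x ^+ n)%g = ssval x *+ n.
  by elim: n => [|n IHn]; rewrite ?expg0 ?expgS ?mulrS //= IHn.
have : (l.-group [set: G]%G)%g.
  apply/pgroupP => q q_pr /(Cauchy q_pr)[x _ ordx].
  have : (x ^+ l == 1)%g by apply/eqP/val_inj; rewrite /= expE sl // ssvalP.
  by rewrite -order_dvdn ordx dvdn_prime2.
rewrite /pgroup cardsT => /(p_natP)[m cardG]; exists m.
by rewrite -cardG /= card_seq_sub.
Qed.

Lemma card_eq_seq (T : choiceType) (A : set T) (s : seq T) :
  uniq s -> (forall x, A x <-> x \in s) -> A #= `I_(size s).
Proof.
move=> uniqs memA; have -> : A = [set` seq_fset tt s].
  apply/seteqP; split=> x; first by move=> /memA; rewrite -(seq_fsetE tt s).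
  by move=> /= sx; apply/memA; rewrite -(seq_fsetE tt s).
by apply/card_eq_fsetP; rewrite size_seq_fset undup_id.
Qed.

(** * Endomorphisms with finite kernel *)

(** In each of the finitely many charts the ideals of polynomials vanishing on
    [Z n] increase, and a closed set is determined by these ideals. *)
Lemma zclosed_stationary (k : closedFieldType) (X : atlas k) (Z : nat -> set X) :
    prevariety X -> (forall n, zclosed (Z n)) ->
    (forall n, Z n.+1 `<=` Z n) ->
  exists N, Z N `<=` Z N.+1.
Proof.
move=> [covX _ _ _ _] closedZ decrZ.
pose J (i : chart X) n : set {mpoly k[dim i]} :=
  [set P | forall x, dom i x -> Z n x -> P.@[coord i x ord0] = 0].
have ascJ i : ascending (J i).
  move=> a b /subnK <- P PJ; elim: (b - a)%N => // n IHn x ix /decrZ.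
  exact: IHn.
have /choice[N statJ] i : stationary (J i).
  apply: noetherian_mpoly (ascJ i) => n.
  split=> [x _ _|P Q JP JQ x ix Zx|P Q JQ x ix Zx].
  - exact: meval0.
  - by rewrite mevalD JP ?JQ ?addr0.
  - by rewrite mevalM JQ ?mulr0.
exists (\max_i N i)%N => x Zx; have [i ix] := covX x; apply: contrapT => nZx.
have leN : (N i <= \max_i N i)%N by apply: leq_bigmax.
have /zopenC/zopenP/(_ i x ix nZx)[P /eqP P0 PZ] := closedZ (\max_i N i).+1.
apply/P0/(ascJ i _ _ leN) => //; apply: (statJ i (\max_i N i).+1).
  exact: leq_trans leN (leqnSn _).
by move=> y iy Zy; apply: contrapT => /eqP /(PZ y iy).
Qed.

(** A name for the points of [A] that carries the structure of [zmodType]. *)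
Definition av_group (k : closedFieldType) (A : abelian_variety k) : Type := A.

Section Group.
Variables (k : closedFieldType) (A : abelian_variety k).

HB.instance Definition _ := gen_eqMixin (av_group A).
HB.instance Definition _ := gen_choiceMixin (av_group A).
HB.instance Definition _ := GRing.isZmodule.Build (av_group A)
  (@av_addA k A) (@av_addC k A) (@av_add0 k A) (@av_addN k A).

Local Notation M := (av_group A).

Lemma av_mulnE n (x : M) : av_muln n (x : A) = x *+ n.
Proof. by elim: n => // n IHn; rewrite mulrS -IHn. Qed.

Lemma zmorphism_addr (X : atlas k) (f g : X -> M) :
  zmorphism (f : X -> A) -> zmorphism (g : X -> A) ->
  zmorphism ((fun x => f x + g x) : X -> A).
Proof. exact: zmorphism_add. Qed.

Lemma zmorphism_sumr (X : atlas k) n (f : nat -> X -> M) :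
  (forall i, zmorphism (f i : X -> A)) ->
  zmorphism ((fun x => \sum_(i < n) f i x) : X -> A).
Proof.
move=> morf; elim: n => [|n IHn].
  rewrite (_ : (fun x => _) = fun=> 0 : M); first exact: zmorphism_cst.
  by apply/funext => x; rewrite big_ord0.
rewrite (_ : (fun x => _) = fun x => \sum_(i < n) f i x + f n x).
  exact: zmorphism_addr.
by apply/funext => x; rewrite big_ord_recr.
Qed.

Lemma zmorphism_finite_eq0 (f : M -> M) (s : seq M) :
  zmorphism (f : A -> A) -> f 0 = 0 -> (forall x, f x \in s) ->
  forall x, f x = 0.
Proof.
have [preA irrA _] := av_variety A; move=> morf f0 fs x; rewrite -[RHS]f0.
apply: (@zmorphism_finite_cst k A A f (size s) (nth (0 : M) s)) => // y.
by exists (index (f y) s); rewrite ?index_mem // nth_index.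
Qed.

(** The closed sets [f^n A] decrease, so [f^n A = f^(n+1) A] for some [n].  Then
    every [x] differs from a value of [f] by an element of the finite kernel of
    [f^n]: finitely many translates of the closed set [f A] cover [A], and by
    irreducibility one of them is [A]. *)
Theorem finite_kernel_surjective (f : {additive M -> M}) :
  zmorphism (f : A -> A) -> finite_set [set x | f x = 0] ->
  forall y, exists x, f x = y.
Proof.
have [preA irrA _] := av_variety A.
move=> morf /finite_seqP[s kers] y.
have {}kers x : f x = 0 -> x \in s.
  by move=> fx; rewrite -[is_true _]/([set` s] x) -kers.
have moriter n : zmorphism (iter n f : A -> A).
  by elim: n => // n IHn; apply: (zmorphism_comp IHn morf).
have closedr n : zclosed (range (iter n f : A -> A)).
  by apply: zclosed_range => //; [apply: (@av_complete k A) | apply: av_variety].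
have [|n stat] := zclosed_stationary preA closedr.
  by move=> n _ [x _ <-]; exists (f x); rewrite // -iterSr.
have iterB x z : iter n f (x - z) = iter n f x - iter n f z.
  by elim: n {stat} => //= n ->; rewrite raddfB.
have [t kert] := iter_kernel_finite n kers.
pose Z a : set A := (fun z : M => z - nth 0 t a) @^-1` range f.
have [||a Za] := @irreducible_cover k A (size t) Z irrA.
- move=> a; apply: (@zclosed_preimage k A A (fun z : M => z - nth 0 t a)).
    apply: (@zmorphism_addr A (fun z => z)); first exact: zmorphism_id.
    exact: zmorphism_cst.
  exact: (closedr 1%N).
- move=> x; have [z _ fz] := stat (iter n f x) (ex_intro2 _ _ x I erefl).
  have tx : (x : M) - f z \in t.
    by apply: kert; rewrite iterB -iterSr /= in fz *; rewrite fz subrr.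
  exists (index ((x : M) - f z) t); first by rewrite index_mem.
  by exists z => //; rewrite nth_index // subKr.
have : Z a (y + nth 0 t a) by rewrite Za.
by rewrite /Z /= addrK => -[x _ fx]; exists x.
Qed.

End Group.

(** * Rigid actions *)

Section Action.
Variables (k : closedFieldType) (A : abelian_variety k) (gT : finGroupType).
Variable rho : gT -> A -> A.
Hypotheses (rho_act : av_action rho) (rho_rigid : rigid rho).

Local Notation M := (av_group A).

Lemma rho_zmorphism g : zmorphism (rho g).
Proof. by have [/(_ g)[[]]] := rho_act. Qed.

Lemma rhoD g : {morph (rho g : M -> M) : x y / x + y}.
Proof. by have [/(_ g)[[]]] := rho_act. Qed.

Lemma rhoM g h x : rho (g * h)%g x = rho g (rho h x).
Proof. by have [_ -> _] := rho_act. Qed.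

Lemma rho1 x : rho 1%g x = x.
Proof.
have [/(_ 1%g)[_ [h [_ rhoK _]]] _ _] := rho_act.
by apply: (can_inj rhoK); rewrite -rhoM mulg1.
Qed.

Lemma rhoX g n x : rho (g ^+ n)%g x = iter n (rho g) x.
Proof. by elim: n => [|n IHn]; rewrite ?rho1 // expgS rhoM IHn. Qed.

Lemma rho0 g : rho g (0 : M) = 0 :> M.
Proof. by apply: (addrI (rho g (0 : M) : M)); rewrite -rhoD !addr0. Qed.

Lemma fixed_by_seq g : g <> 1%g ->
  exists2 s : seq M, uniq s & forall x : M, x \in s = ((rho g x : M) == x).
Proof.
move=> /rho_rigid[finF _]; have /finite_seqP[s defF] :
  @finite_set M (fixed_by rho g) by [].
exists (undup s) => [|x]; first exact: undup_uniq.
rewrite mem_undup; apply/idP/eqP => [sx|fx].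
  by rewrite -[_ = _]/(fixed_by rho g x) defF.
by rewrite -[is_true _]/([set` s] x) -defF.
Qed.

(** The sum over the powers of [h] is fixed by [h], so by rigidity it takes
    finitely many values. *)
Lemma orbit_sum_eq0 (h : gT) (n : nat) : h <> 1%g -> (h ^+ n = 1)%g ->
  forall x : M, \sum_(i < n) (rho (h ^+ i)%g x : M) = 0.
Proof.
move=> h1 hn; have [s _ mems] := fixed_by_seq h1.
pose N (x : M) : M := \sum_(i < n) (rho (h ^+ i)%g x : M).
apply: (@zmorphism_finite_eq0 k A N s) => [||x].
- apply: (@zmorphism_sumr k A A n (fun i => rho (h ^+ i)%g)) => i.
  exact: rho_zmorphism.
- by apply: big1 => i _; apply: rho0.
rewrite mems; apply/eqP.
have -> : rho h (N x) =
    \sum_(i < n) (rho (h ^+ i.+1)%g x : M).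
  rewrite /N (big_morph _ (@rhoD h) (rho0 h)).
  by apply: eq_bigr => i _; rewrite expgS rhoM.
rewrite {}/N; case: n hn => [|n] hn; first by rewrite !big_ord0.
by rewrite big_ord_recr [RHS]big_ord_recl /= hn addrC.
Qed.

(** The powers of [g] with exponent a multiple of [l ^ r] are those of an element
    of order [l]. *)
Lemma order_prime_power_sum (l r : nat) (g : gT) : prime l ->
  #[g]%g = (l ^ r.+1)%N ->
  forall x : M, \sum_(i < l) (rho (g ^+ (i * l ^ r))%g x : M) = 0.
Proof.
move=> l_pr ordg x; have l_gt1 := prime_gt1 l_pr.
under eq_bigr do rewrite mulnC expgM; apply: orbit_sum_eq0.
  by move=> /eqP; rewrite -order_dvdn ordg dvdn_Pexp2l // ltnn.
by apply/eqP; rewrite -expgM -expnSr -ordg expg_order.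
Qed.

End Action.

Theorem proposition3p3 (k : closedFieldType) (p : nat)
    (hp : has_characteristic k p)
    (A : abelian_variety k) (gT : finGroupType) (rho : gT -> A -> A)
    (hrho : av_action rho) (hrig : rigid rho)
    (l : nat) (hl : prime l) (hlp : l = p -> (0 < av_p_rank A p)%N)
    (r : nat) (hr : (1 <= r)%N) :
  (forall (P : A) (g : gT), #[g]%g = (l ^ r)%N -> rho g P = P ->
     av_torsion A l P) /\
  (cyclic [set: gT]%G -> #|gT| = (l ^ r)%N ->
     [/\ av_subgroup (fixed_points rho),
         fixed_points rho `<=` av_torsion A l
       & exists m n : nat,
         [/\ fixed_points rho #= `I_(l ^ m),
             av_torsion A l #= `I_(l ^ n)
           & (m%:R : rat) = n%:R / ((l - 1) * l ^ (r - 1))%N%:R]]).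
Proof.
case: r hr => // r _; have l_gt1 := prime_gt1 hl.
pose M := av_group A.
have tors (P : M) g : #[g]%g = (l ^ r.+1)%N -> rho g P = P -> P *+ l = 0.
  move=> ordg fixP; rewrite -(order_prime_power_sum hrho hrig hl ordg P).
  rewrite (eq_bigr (fun=> P)) ?sumr_const ?card_ord // => i _.
  by rewrite (rhoX hrho); elim: (_ * _)%N => //= n ->.
split=> [P g ordg fixP|/cyclicP[g genG] cardG].
  by rewrite /av_torsion /= av_mulnE; apply: tors fixP.
have ordg : #[g]%g = (l ^ r.+1)%N by rewrite -cardG /order -genG cardsT.
have g1 : g <> 1%g.
  move=> /eqP; rewrite -order_eq1 ordg => /eqP.
  by move=> /(congr1 (logn l)); rewrite pfactorK // logn1.
have fixE (x : M) : fixed_points rho x <-> rho g x = x.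
  split=> [|gx h]; first exact.
  have /cycleP[n ->] : h \in <[g]>%g by rewrite -genG inE.
  by rewrite (rhoX hrho); elim: n => //= n ->.
have [s uniqs mems] := fixed_by_seq hrig g1.
pose G : {additive M -> M} := HB.pack (rho g : M -> M)
  (Algebra.isNmodMorphism.Build M M (rho g)
    (conj (rho0 hrho g) (@rhoD _ _ _ _ hrho g))).
pose f : {additive M -> M} := G \- idfun.
have fE x : (f x == 0) = (x \in s) by rewrite mems subr_eq0.
have surjf : forall y, exists x, f x = y.
  apply: finite_kernel_surjective.
    apply: (@zmorphism_addr k A A); first exact: rho_zmorphism.
    apply: (@zmorphism_opp k A A); exact: zmorphism_id.
  apply/finite_seqP; exists s; apply/seteqP; split=> x /=.
    by move=> /eqP; rewrite fE.
  by rewrite -fE => /eqP.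
pose d := ((l - 1) * l ^ r)%N.
have [t [uniqt sizet memt]] := iter_kernel_card d surjf uniqs (fun x => esym (fE x)).
have torsE (x : M) : av_torsion A l x <-> x \in t.
  rewrite memt /av_torsion /= av_mulnE.
  have iterE : iter d f x = iter d (fun y => G y - y) x by [].
  rewrite iterE; apply: iff_trans (torsion_iter_kernel (g := G) x hl _) _.
    move=> y; rewrite -[RHS](order_prime_power_sum hrho hrig hl ordg y).
    by apply: eq_bigr => i _; rewrite (rhoX hrho).
  exact: (rwP eqP).
have fixs (x : M) : fixed_points rho x <-> x \in s.
  by rewrite fixE mems; split=> [-> | /eqP].
have fixtors : fixed_points rho `<=` av_torsion A l.
  by move=> x /fixE gx; rewrite /av_torsion /= av_mulnE; apply: tors gx.
have fix0 : fixed_points rho (av_zero A) by apply/fixE; apply: (rho0 hrho).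
have fixD (x y : M) : fixed_points rho x -> fixed_points rho y ->
    fixed_points rho (x + y).
  by move=> /fixE gx /fixE gy; apply/fixE; rewrite (rhoD hrho) gx gy.
have fixN (x : M) : fixed_points rho x -> fixed_points rho (- x).
  move=> /fixE gx; apply/fixE; transitivity (- (rho g x : M)); last by rewrite gx.
  exact: (raddfN G).
split=> //.
have [m sizes] : exists m, size s = (l ^ m)%N.
  apply: (exponent_prime_card hl uniqs).
  - exact/fixs.
  - by move=> x y /fixs fx /fixs fy; apply/fixs/fixD.
  - by move=> x /fixs fx; apply/fixs/fixN.
  - by move=> x /fixs/fixtors; rewrite /av_torsion /= av_mulnE.
exists m, (m * d)%N; split.
- by rewrite -sizes; apply: (@card_eq_seq M _ s).
- by rewrite expnM -sizes -sizet; apply: (@card_eq_seq M _ t).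
rewrite subSS subn0 -/d natrM mulfK // Num.Theory.pnatr_eq0 -lt0n muln_gt0.
by rewrite subn_gt0 l_gt1 expn_gt0 prime_gt0.
Qed.
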